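(* Let $ABC$ be a nondegenerate triangle with $\angle BAC\neq 90^\circ$, let $M$ be the intersection point of the tangents to the circumcircle $\omega_{ABC}$ at $B$ and $C$, and let $\omega_{tan}$ be the circle with centre $M$ passing through $B$ and $C$. Then, for every admissible pair of cevians $BB_A, CC_A$ with Miquel–Steiner point $M_A$, the lines $BB_A$ and $CC_A$ are perpendicular if and only if $M_A\in\omega_{tan}$.
   Context: Work in the Euclidean plane with a nondegenerate triangle $ABC$. An admissible pair of cevians consists of lines $BB_A$ and $CC_A$, where $B_A$ is a point of line $AC$ with $B_A\neq A, C$, and $C_A$ is a point of line $AB$ with $C_A\neq A, B$ (the points may lie outside the sides), such that $BB_A$ and $CC_A$ are not parallel. Let $N_A$ be the intersection point of $BB_A$ and $CC_A$. The circumcircles of the four triangles $ABB_A$, $ACC_A$, $CB_AN_A$, $BC_AN_A$ have a unique common point $M_A$, called the Miquel–Steiner point of triangle $ABC$ with cevians $BB_A, CC_A$ (equivalently, $M_A$ is the common point other than $A$ of the circumcircles of $ABB_A$ and $ACC_A$). *)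

(* Defs.v *)
(* MathComp / MathComp-Analysis *)
From mathcomp Require Import all_boot all_order all_algebra.
From mathcomp Require Import all_classical all_reals all_analysis.

Set Implicit Arguments.
Unset Strict Implicit.
Unset Printing Implicit Defensive.

Import Order.TTheory GRing.Theory Num.Theory.

Local Open Scope classical_set_scope.
Local Open Scope ring_scope.

Section PlaneGeometry.
Variable R : realType.

Local Notation point := 'rV[R]_2.

Implicit Types (P Q S : point) (L w : set point).

Definition dot (u v : point) : R := (u *m v^T) 0 0.

(* The norm `|u| of the library on row vectors is the sup norm, hence this
   Euclidean one. *)
Definition enorm (u : point) : R := Num.sqrt (dot u u).

Definition dist P Q : R := enorm (P - Q).

(* The angle PQS, with vertex Q. *)
Definition angle P Q S : R :=
  acos (dot (P - Q) (S - Q) / (enorm (P - Q) * enorm (S - Q))).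

(* A genuine line only when P != Q. *)
Definition line P Q : set point :=
  [set X | exists t : R, X = P + t *: (Q - P)].

Definition is_line L := exists P Q, P != Q /\ L = line P Q.

Definition collinear P Q S := exists L, is_line L /\ [/\ L P, L Q & L S].

Definition parallel L1 L2 := L1 = L2 \/ L1 `&` L2 = set0.

Definition perpendicular L1 L2 :=
  forall P P' Q Q' : point, L1 P -> L1 P' -> L2 Q -> L2 Q' ->
    dot (P' - P) (Q' - Q) = 0.

Definition circle P (r : R) : set point := [set X | dist X P = r].

Definition is_circle w := exists P, exists2 r : R, 0 < r & w = circle P r.

Definition circumcircle P Q S w := is_circle w /\ [/\ w P, w Q & w S].

(* L is the tangent to the circle w at P. *)
Definition tangent w P L := is_line L /\ L `&` w = [set P].

Definition admissible (A B C BA CA : point) :=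
  [/\ line A C BA /\ (BA != A /\ BA != C),
      line A B CA /\ (CA != A /\ CA != B) &
      ~ parallel (line B BA) (line C CA)].

Definition Miquel_Steiner_point (A B C BA CA MA : point) :=
  exists (NA : point) (w1 w2 w3 w4 : set point),
  [/\ line B BA `&` line C CA = [set NA],
      circumcircle A B BA w1 /\ circumcircle A C CA w2,
      circumcircle C BA NA w3 /\ circumcircle B CA NA w4 &
      w1 `&` w2 `&` w3 `&` w4 = [set MA]].

End PlaneGeometry.

(* Main.v *)
Require Import Defs.
From mathcomp Require Import all_boot all_order all_algebra.
From mathcomp Require Import all_classical all_reals all_analysis.
From mathcomp Require Import ring lra.

Set Implicit Arguments.
Unset Strict Implicit.
Unset Printing Implicit Defensive.

Import Order.TTheory GRing.Theory Num.Theory.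

Local Open Scope classical_set_scope.
Local Open Scope ring_scope.

(** Put A at the origin and write u = AB, v = AC, AB_A = s v, AC_A = t u,
    AM_A = x u + y v, a = u.v, b = v.v, c = u.u.  A circle through the origin
    is the zero set of |X|^2 minus a linear form, so the circles ABB_A and
    ACC_A give |AM_A|^2 = x c + y s b = x t c + y b, which determine (x, y) up
    to the trivial solution (0, 0).  That solution is excluded because A lies
    on the line CB_A and hence not on the circle CB_AN_A.  The tangents at B
    and C meet in M with AM = (b u + c v) / (2 a), so omega_tan has equation
    a (|X|^2 - x c - y b) + b c (1 - x - y) = 0.  Substituting (x, y), this
    becomes (1 - s) (1 - t) (s b + t c - a (1 + s t)) = 0, where the last
    factor is the scalar product of BB_A and CC_A up to sign. *)

(** * Scalar products and determinants in the plane *)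

Section Dot.
Variable R : realType.
Implicit Types (u v P Q X : 'rV[R]_2) (k : R).

Lemma dotE u v : dot u v = u 0 0 * v 0 0 + u 0 1 * v 0 1.
Proof.
rewrite /dot mxE big_ord_recl big_ord1 !mxE (_ : lift 0 0 = 1) //.
exact: val_inj.
Qed.

Lemma dotC u v : dot u v = dot v u.
Proof. by rewrite !dotE; ring. Qed.

Lemma dotDl u1 u2 v : dot (u1 + u2) v = dot u1 v + dot u2 v.
Proof. by rewrite !dotE !mxE; ring. Qed.

Lemma dotZl k u v : dot (k *: u) v = k * dot u v.
Proof. by rewrite !dotE !mxE; ring. Qed.

Lemma dotNl u v : dot (- u) v = - dot u v.
Proof. by rewrite !dotE !mxE; ring. Qed.

Lemma dotDr u v1 v2 : dot u (v1 + v2) = dot u v1 + dot u v2.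
Proof. by rewrite !dotE !mxE; ring. Qed.

Lemma dotZr k u v : dot u (k *: v) = k * dot u v.
Proof. by rewrite !dotE !mxE; ring. Qed.

Lemma dotNr u v : dot u (- v) = - dot u v.
Proof. by rewrite !dotE !mxE; ring. Qed.

Definition dot_bilinear := (dotDl, dotNl, dotZl, dotDr, dotNr, dotZr).

Lemma dot_ge0 u : 0 <= dot u u.
Proof. by rewrite dotE addr_ge0 // -expr2 sqr_ge0. Qed.

Lemma row2_eq u v : u 0 0 = v 0 0 -> u 0 1 = v 0 1 -> u = v.
Proof.
move=> h0 h1; apply/rowP => -[[|[|//]] hi].
- by rewrite (_ : Ordinal hi = 0) //; apply: val_inj.
- by rewrite (_ : Ordinal hi = 1) //; apply: val_inj.
Qed.

Lemma dot_eq0 u : (dot u u == 0) = (u == 0).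
Proof.
apply/eqP/eqP => [|->]; last by rewrite dotE !mxE; ring.
rewrite dotE -!expr2 => /eqP; rewrite paddr_eq0 ?sqr_ge0 // !sqrf_eq0.
by case/andP => /eqP h0 /eqP h1; apply: row2_eq; rewrite !mxE.
Qed.

Definition det2 u v : R := u 0 0 * v 0 1 - u 0 1 * v 0 0.

(** Cramer's rule in the basis [u], [v]. *)
Lemma det2_decomp u v X : det2 u v != 0 ->
  X = (det2 X v / det2 u v) *: u + (det2 u X / det2 u v) *: v.
Proof.
by rewrite /det2 => d0; apply: row2_eq; rewrite !mxE; field.
Qed.

Lemma det2_dot_decomp u v : det2 u v = 0 -> u != 0 ->
  v = (dot v u / dot u u) *: u.
Proof.
rewrite -dot_eq0 => d0 u0; have d0' : u 0 0 * v 0 1 = u 0 1 * v 0 0.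
  by apply/eqP; rewrite -subr_eq0; apply/eqP.
apply: (scalerI u0); rewrite scalerA mulrC divfK //.
move: d0'; rewrite !dotE => d0'.
by apply: row2_eq; rewrite !mxE; ring: d0'.
Qed.

(** The 3 by 3 matrix of scalar products of [u], [v], [P] with [u], [v], [Q] is singular, since
    three vectors of the plane are dependent. Expanding its determinant gives the identity. *)
Lemma gram_dot u v P Q :
  (dot u u * dot v v - dot u v ^+ 2) * dot P Q =
  dot v v * dot P u * dot Q u
  - dot u v * (dot P u * dot Q v + dot P v * dot Q u)
  + dot u u * dot P v * dot Q v.
Proof. by rewrite !dotE; ring. Qed.

(** With the origin at [Q], squaring the distances lets the square of [P - Q] cancel, so the
    equation of a circle through [Q] is linear in its centre. *)
Lemma dist_eqE X P Q :
  dist X P = dist Q P <->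
  2 * dot (X - Q) (P - Q) = dot (X - Q) (X - Q).
Proof.
have -> : dist X P = dist Q P <-> dot (X - P) (X - P) = dot (Q - P) (Q - P).
  split=> [|h]; last by rewrite /dist /enorm h.
  move=> /(congr1 (fun z => z ^+ 2)).
  by rewrite /dist /enorm !sqr_sqrtr ?dot_ge0.
by rewrite !dotE !mxE; split=> h; lra.
Qed.

End Dot.

(** * Lines, circles and tangents turned into vector equations *)

Section Geometry.
Variable R : realType.
Implicit Types (A B C P Q X O M : 'rV[R]_2) (L w : set 'rV[R]_2).

Lemma line_left P Q : line P Q P.
Proof. by exists 0; rewrite scale0r addr0. Qed.

Lemma line_right P Q : line P Q Q.
Proof. by exists 1; rewrite scale1r addrC subrK. Qed.

Lemma noncollinear_det2 A B C : ~ collinear A B C -> det2 (B - A) (C - A) != 0.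
Proof.
move=> ncol; apply/eqP => d0; apply: ncol.
have [BA|nBA] := eqVneq B A; last first.
  exists (line A B); split; first by exists A, B; rewrite eq_sym.
  split; [exact: line_left|exact: line_right|].
  exists (dot (C - A) (B - A) / dot (B - A) (B - A)).
  by rewrite -(det2_dot_decomp d0) ?subr_eq0 // addrC subrK.
have [CA|nCA] := eqVneq C A; last first.
  exists (line A C); split; first by exists A, C; rewrite eq_sym.
  by rewrite BA; split; [exact: line_left|exact: line_left|exact: line_right].
(* All three points coincide, and any direction gives a line through them. *)
exists (line A (A + const_mx 1)); split.
  exists A, (A + const_mx 1); split=> //; apply/eqP => /rowP /(_ 0) /eqP.
  by rewrite !mxE eq_sym -subr_eq0 addrAC subrr add0r oner_eq0.
by rewrite BA CA; split; exact: line_left.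
Qed.

Lemma circle_dist_eq O r X Q : circle O r Q ->
  circle O r X <-> dist X O = dist Q O.
Proof. by rewrite /circle /= => ->. Qed.

(* Reflecting P in the foot of the perpendicular from O to L gives a second
   point of L on the circle, unless P is that foot. *)
Lemma tangent_dot O r P L X : tangent (circle O r) P L -> L X ->
  dot (X - P) (P - O) = 0.
Proof.
move=> [[S [T [ST ->]]] LP].
have [/= [p hp] Pw] : (line S T `&` circle O r) P by rewrite LP.
have d0 : dot (T - S) (T - S) != 0.
  by rewrite dot_eq0 subr_eq0 eq_sym.
have [k kE] : exists k, k * dot (T - S) (T - S) = - 2 * dot (P - O) (T - S).
  by exists (- 2 * dot (P - O) (T - S) / dot (T - S) (T - S)); rewrite divfK.
have : (line S T `&` circle O r) (P + k *: (T - S)).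
  split; first by exists (p + k); rewrite hp scalerDl addrA.
  apply/(circle_dist_eq _ Pw)/dist_eqE.
  have -> : O - P = - 1 *: (P - O) by rewrite scaleN1r opprB.
  rewrite addrAC subrr add0r.
  move: kE; move: (T - S) (P - O) => d e kE.
  rewrite !dot_bilinear (dotC d e); ring: kE.
rewrite LP /= => /eqP; rewrite -subr_eq0 addrAC subrr add0r scaler_eq0.
rewrite -[T - S == 0]dot_eq0 (negPf d0) orbF => /eqP k0 [q ->].
rewrite hp addrAC opprD addrA subrr add0r -scaleNr -scalerDl -hp dotZl.
move/eqP: kE; rewrite k0 mul0r eq_sym mulf_eq0 oppr_eq0 pnatr_eq0 /= dotC.
by move=> /eqP ->; rewrite mulr0.
Qed.

Lemma perpendicular_lineE P P' Q Q' :
  perpendicular (line P P') (line Q Q') <-> dot (P' - P) (Q' - Q) = 0.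
Proof.
split=> [|h]; first by apply; [exact: line_left|exact: line_right|
  exact: line_left|exact: line_right].
move=> X X' Y Y' [x ->] [x' ->] [y ->] [y' ->].
have e (S T : 'rV[R]_2) (k l : R) : S + k *: T - (S + l *: T) = (k - l) *: T.
  by rewrite opprD addrACA subrr add0r scalerBl.
by rewrite !e dotZl dotZr h !mulr0.
Qed.

End Geometry.

(** Subtracting the two circle equations gives x c (1 - t) = y b (1 - s), so (x, y) = l ((1 - s) b,
    (1 - t) c). Cancelling l b c in the first equation leaves l q = 1 - s t. *)
Lemma Miquel_power_factor (F : realFieldType) (a b c s t x y : F) :
  a != 0 -> b != 0 -> c != 0 -> s != 1 -> t != 1 ->
  (1 - s) ^+ 2 * b + 2 * (1 - s) * (1 - t) * a + (1 - t) ^+ 2 * c != 0 ->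
  (x != 0) || (y != 0) ->
  x ^+ 2 * c + 2 * x * y * a + y ^+ 2 * b = x * c + y * s * b ->
  x ^+ 2 * c + 2 * x * y * a + y ^+ 2 * b = x * t * c + y * b ->
  (1 + s * t) * a - s * b - t * c = 0 <->
  a * (x ^+ 2 * c + 2 * x * y * a + y ^+ 2 * b - x * c - y * b)
    + b * c * (1 - x - y) = 0.
Proof.
move=> a0 b0 c0; rewrite ![_ == 1]eq_sym -![1 == _]subr_eq0 => s1 t1.
set q := _ + _ + _ => q0 xy0 e1 e2.
pose l := x / ((1 - s) * b).
have sb0 : (1 - s) * b != 0 by rewrite mulf_neq0.
have xE : x = (1 - s) * b * l by rewrite mulrC divfK.
have yE : y = (1 - t) * c * l.
  apply: (mulfI sb0).
  have -> : (1 - s) * b * ((1 - t) * c * l) = x * ((1 - t) * c) by rewrite xE; ring.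
  by move: e2; rewrite e1 => e2; lra.
have l0 : l != 0.
  by apply: contraTneq xy0 => l0; rewrite xE yE l0 !mulr0 eqxx.
have lq : l * q = 1 - s * t.
  apply: (mulfI (mulf_neq0 l0 (mulf_neq0 b0 c0))).
  move: e1; rewrite xE yE /q => e1.
  by lra.
have -> : a * (x ^+ 2 * c + 2 * x * y * a + y ^+ 2 * b - x * c - y * b)
    + b * c * (1 - x - y) = b * c / q *
    ((1 - s) * (1 - t) * ((1 + s * t) * a - s * b - t * c)).
  apply: (mulfI q0); rewrite e1.
  rewrite mulrA [q * (_ / q)]mulrC divfK // xE yE.
  (* Once multiplied by [q], the expression involves [l] only through [l * q], which [lq]
     eliminates. *)
  transitivity (b * c * (q - l * q * (a * (1 - s) * (1 - t) + (1 - s) * b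
    + (1 - t) * c))); first by ring.
  by rewrite lq /q; ring.
split=> [->|/eqP]; first by rewrite !mulr0.
by rewrite !mulf_eq0 invr_eq0 (negPf b0) (negPf c0) (negPf q0) (negPf s1) (negPf t1) /=
  => /eqP.
Qed.

(* o is the circumcentre and mu the pole of the line uv with respect to the
   circle through 0, u and v. *)
Lemma pole_dot (R : realType) (u v o mu : 'rV[R]_2) : u != v ->
  2 * dot u o = dot u u -> 2 * dot v o = dot v v ->
  dot (mu - u) (u - o) = 0 -> dot (mu - v) (v - o) = 0 ->
  [/\ 2 * dot mu u = dot u u + 2 * dot mu o,
      2 * dot mu v = dot v v + 2 * dot mu o &
      2 * dot u v * dot mu o = dot u u * dot v v].
Proof.
move=> uv ou ov; rewrite !dot_bilinear => tu tv.
have U : 2 * dot mu u = dot u u + 2 * dot mu o by lra.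
have V : 2 * dot mu v = dot v v + 2 * dot mu o by lra.
split=> //.
have uv0 : dot (u - v) (u - v) != 0 by rewrite dot_eq0 subr_eq0.
(* The products of [mu] with [u] and [v] are known up to [dot mu o], so the Gram identity for [mu]
   and [o] is an equation in that single unknown; the quadratic terms cancel, and the square of
   [u - v] factors out. *)
apply: (mulfI uv0); have := gram_dot u v mu o.
rewrite !dot_bilinear (dotC v u) (dotC o u) (dotC o v) => g.
move: U V ou ov g; move: (dot mu u) (dot mu v) (dot mu o) (dot u o) (dot v o).
move: (dot u u) (dot v v) (dot u v) => c b a p q k i j U V ou ov g.
have -> : 2 * a * k = a * (2 * k) by ring.
have h2 : (2 : R) != 0 by rewrite pnatr_eq0.
have pE : p = c / 2 + k by apply: (mulfI h2); rewrite U; field.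
have qE : q = b / 2 + k by apply: (mulfI h2); rewrite V; field.
have iE : i = c / 2 by apply: (mulfI h2); rewrite ou; field.
have jE : j = b / 2 by apply: (mulfI h2); rewrite ov; field.
by move: g; rewrite pE qE iE jE => g; lra.
Qed.

Lemma angle_pi2 (R : realType) (P Q S : 'rV[R]_2) :
  dot (P - Q) (S - Q) = 0 -> angle P Q S = pi / 2.
Proof. by rewrite /angle => ->; rewrite mul0r acos0. Qed.

(* A circle meets a line in at most two points. *)
Lemma circumcircle_collinear3 (R : realType) (A C : 'rV[R]_2) (s : R) N w : A != C ->
  s != 0 -> s != 1 -> circumcircle C (A + s *: (C - A)) N w -> ~ w A.
Proof.
move=> AC s0 s1 [[P [r _ ->]] [wC wB _]] wA.
move/(circle_dist_eq _ wA)/dist_eqE: wC.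
move/(circle_dist_eq _ wA)/dist_eqE: wB.
rewrite addrAC subrr add0r !dotZl dotZr => e2 e1.
have d0 : dot (C - A) (C - A) != 0 by rewrite dot_eq0 subr_eq0 eq_sym.
suff /eqP : s * dot (C - A) (C - A) * (1 - s) = 0.
  by rewrite !mulf_eq0 (negPf s0) (negPf d0) subr_eq0 eq_sym (negPf s1).
by rewrite -e1 in e2 *; lra.
Qed.

Theorem mainTheorem2 (R : realType) (A B C : 'rV[R]_2)
  (ABC_nondegenerate : ~ collinear A B C)
  (angleA : angle B A C != pi / 2)
  (w tB tC : set 'rV[R]_2)
  (w_circumcircle : circumcircle A B C w)
  (tB_tangent : tangent w B tB)
  (tC_tangent : tangent w C tC)
  (M : 'rV[R]_2)
  (M_intersection : tB `&` tC = [set M])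
  (wtan : set 'rV[R]_2)
  (wtan_center : exists2 r : R, 0 < r & wtan = circle M r)
  (wtan_B : wtan B)
  (wtan_C : wtan C) :
  forall BA CA : 'rV[R]_2, admissible A B C BA CA ->
  forall MA : 'rV[R]_2, Miquel_Steiner_point A B C BA CA MA ->
    (perpendicular (line B BA) (line C CA) <-> wtan MA).
Proof.
move=> BA CA [[[s BAE] [BA_A BA_C]] [[t CAE] [CA_A CA_B]] _].
move=> MA [N] [w1] [w2] [w3] [w4] [_ [cc1 cc2] [cc3 _] w1234].
have D0 := noncollinear_det2 ABC_nondegenerate.
have subA (X Y : 'rV[R]_2) : X - Y = (X - A) - (Y - A).
  by rewrite opprB addrA subrK.
have [BA0 CA0 BC0] : [/\ B != A, C != A & B - A != C - A].
  split; apply: contra_neq D0 => e; rewrite ?e /det2 ?subrr ?mxE;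
    rewrite ?mul0r ?mulr0 ?subrr //.
  by rewrite mulrC subrr.
have s0 : s != 0 by apply: contraNneq BA_A => s0; rewrite BAE s0 scale0r addr0.
have t0 : t != 0 by apply: contraNneq CA_A => t0; rewrite CAE t0 scale0r addr0.
have s1 : s != 1.
  by apply: contraNneq BA_C => s1; rewrite BAE s1 scale1r addrC subrK.
have t1 : t != 1.
  by apply: contraNneq CA_B => t1; rewrite CAE t1 scale1r addrC subrK.
have [[[w1m w2m] w3m] _] : (w1 `&` w2 `&` w3 `&` w4) MA by rewrite w1234.
have m0 : MA - A != 0.
  rewrite subr_eq0; apply/eqP => MAA; rewrite MAA BAE in w3m cc3.
  by apply: circumcircle_collinear3 cc3 w3m; rewrite // eq_sym.
have [tBM tCM] : (tB `&` tC) M by rewrite M_intersection.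
case: w_circumcircle => [[ O [r r_gt0 wE]] [wA wB wC]].
rewrite wE in tB_tangent tC_tangent wA wB wC.
have := tangent_dot tC_tangent tCM; have := tangent_dot tB_tangent tBM.
move/(circle_dist_eq _ wA)/dist_eqE: wC; move/(circle_dist_eq _ wA)/dist_eqE: wB.
rewrite (subA M) (subA M C) (subA B O) (subA C O) => ou ov tu tv.
have [U V K] := pole_dot BC0 ou ov tu tv.
have a0 : dot (B - A) (C - A) != 0.
  by apply: contra_neq angleA => /angle_pi2.
have b0 : dot (C - A) (C - A) != 0 by rewrite dot_eq0 subr_eq0.
have c0 : dot (B - A) (B - A) != 0 by rewrite dot_eq0 subr_eq0.
move: wtan_center => [r' _ wtanE]; rewrite wtanE in wtan_B *.
have wtan_MA := circle_dist_eq MA wtan_B.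
(* Equality of the squared distances to [M], with the square of [M - A] removed from both sides. *)
have {}wtan_MA : circle M r' MA <->
    dot (MA - A) (MA - A) - 2 * dot (M - A) (MA - A)
    = dot (B - A) (B - A) - 2 * dot (M - A) (B - A).
  rewrite wtan_MA dist_eqE (subA MA B) (subA M B).
  move: (MA - A) (B - A) (M - A) => m u mu.
  rewrite !dot_bilinear (dotC u m) (dotC u mu) (dotC m mu).
  by split=> ?; lra.
rewrite wtan_MA perpendicular_lineE (subA BA) (subA CA) BAE CAE.
move: cc1 cc2 w1m w2m.
move=> [[P1 [r1 _ ->]] [w1A w1B w1BA]] [[P2 [r2 _ ->]] [w2A w2C w2CA]].
move=> /(circle_dist_eq _ w1A)/dist_eqE e1m /(circle_dist_eq _ w2A)/dist_eqE e2m.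
move/(circle_dist_eq _ w1A)/dist_eqE: w1B => e1B.
move/(circle_dist_eq _ w1A)/dist_eqE: w1BA => e1BA.
move/(circle_dist_eq _ w2A)/dist_eqE: w2C => e2C.
move/(circle_dist_eq _ w2A)/dist_eqE: w2CA => e2CA.
rewrite BAE in e1BA; rewrite CAE in e2CA.
have addAK (X : 'rV[R]_2) : A + X - A = X by rewrite addrAC subrr add0r.
rewrite !addAK in e1BA e2CA *.
have mE := det2_decomp (MA - A) D0.
move: (det2 (MA - A) (C - A) / _) (det2 (B - A) (MA - A) / _) mE => x y mE.
clear -s0 t0 s1 t1 m0 a0 b0 c0 U V K D0 mE e1m e2m e1B e1BA e2C e2CA.
(* From here on only vectors issued from [A] remain: [m], [u], [v], [mu], [o] lead to [MA], [B],
   [C], [M], [O], and [p1], [p2] to the centres of [w1], [w2]. *)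
move: (MA - A) (B - A) (C - A) (M - A) (O - A) (P1 - A) (P2 - A)
  m0 a0 b0 c0 U V K D0 mE e1m e2m e1B e1BA e2C e2CA.
move=> m u v mu o p1 p2 m0 a0 b0 c0 U V K D0 mE e1m e2m e1B e1BA e2C e2CA.
have xy0 : (x != 0) || (y != 0).
  rewrite -negb_and; apply: contra_neqN m0 => /andP[/eqP x0 /eqP y0].
  by rewrite mE x0 y0 !scale0r addr0.
(* This is the square of (1 - s) v + (1 - t) u, a nonzero vector because [u], [v] are independent
   and [s] differs from 1. *)
have q0 : (1 - s) ^+ 2 * dot v v + 2 * (1 - s) * (1 - t) * dot u v
    + (1 - t) ^+ 2 * dot u u != 0.
  have -> : (1 - s) ^+ 2 * dot v v + 2 * (1 - s) * (1 - t) * dot u v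
      + (1 - t) ^+ 2 * dot u u
      = dot ((1 - s) *: v + (1 - t) *: u) ((1 - s) *: v + (1 - t) *: u).
    rewrite !(dotDl, dotDr, dotZl, dotZr) (dotC v u); ring.
  rewrite dot_eq0; apply: contra_neq s1 => w0.
  apply/esym/eqP; rewrite -subr_eq0; apply/eqP/(mulIf D0); rewrite mul0r.
  have -> : (1 - s) * det2 u v = det2 u ((1 - s) *: v + (1 - t) *: u).
    by rewrite /det2 !mxE; ring.
  by rewrite w0 /det2 !mxE; ring.
have sq : dot m m = x ^+ 2 * dot u u + 2 * x * y * dot u v + y ^+ 2 * dot v v.
  by rewrite mE !dot_bilinear (dotC v u); ring.
have vp1 : 2 * dot v p1 = s * dot v v.
  by apply: (mulfI s0); move: e1BA; rewrite !(dotZl, dotZr) => <-; ring.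
have up2 : 2 * dot u p2 = t * dot u u.
  by apply: (mulfI t0); move: e2CA; rewrite !(dotZl, dotZr) => <-; ring.
(* On [w1] the square of a vector equals the linear form [2 * dot _ p1], whose values at [u] and [v]
   are known from [B] and [BA]. *)
have e1 : dot m m = x * dot u u + y * s * dot v v.
  by rewrite -e1m {1}mE dotDl !dotZl -e1B -[y * s * _]mulrA -vp1; ring.
have e2 : dot m m = x * t * dot u u + y * dot v v.
  by rewrite -e2m {1}mE dotDl !dotZl -e2C -[x * t * _]mulrA -up2; ring.
have mum : 2 * dot mu m = x * dot u u + y * dot v v + (x + y) * (2 * dot mu o).
  have -> : 2 * dot mu m = x * (2 * dot mu u) + y * (2 * dot mu v).
    by rewrite mE dotDr !dotZr; ring.
  by rewrite U V; ring.
have [F1 F2] := Miquel_power_factor a0 b0 c0 s1 t1 q0 xy0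
  (etrans (esym sq) e1) (etrans (esym sq) e2).
rewrite -sq in F1 F2.
have perpE : dot (s *: v - u) (t *: u - v)
    = (1 + s * t) * dot u v - s * dot v v - t * dot u u.
  by rewrite !dot_bilinear (dotC v u); ring.
(* The left-hand side is a times the power of M_A with respect to
   omega_tan. *)
have powE : dot u v * (dot m m - x * dot u u - y * dot v v)
    + dot v v * dot u u * (1 - x - y)
    = dot u v * (dot m m - 2 * dot mu m - (dot u u - 2 * dot mu u)).
  by rewrite mum U (mulrC (dot v v)) -K; ring.
rewrite perpE; split=> [/F1|/eqP].
  rewrite powE => /eqP; rewrite mulf_eq0 (negPf a0) subr_eq0 => /eqP //.
by rewrite -subr_eq0 => /eqP h; apply: F2; rewrite powE h mulr0.
Qed.
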